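(* (Graded Uniqueness Theorem) Let $E$ be a graph, and let $R$ be a commutative ring with unit. If $S$ is a $\mathbb{Z}$-graded ring and $\phi : L_R(E) \to S$ is a graded ring homomorphism with the property that $\phi(\lambda v) \neq 0$ for all $v \in E^0$ and all $\lambda \in R \setminus \{0\}$, then $\phi$ is injective.
   Context: Graphs: a graph is a directed graph $E=(E^0,E^1,r,s)$ with countable sets $E^0$ (vertices), $E^1$ (edges) and maps $r,s:E^1\to E^0$ (range, source). A vertex $v$ is regular, $v\in E^0_{\mathrm{reg}}$, if $0<|s^{-1}(v)|<\infty$. A path of length $n\ge 1$ is $\alpha=e_1\cdots e_n$ with $e_i\in E^1$ and $r(e_i)=s(e_{i+1})$; put $|\alpha|=n$, $s(\alpha)=s(e_1)$, $r(\alpha)=r(e_n)$. Vertices are paths of length $0$ (with $r(v)=s(v)=v$). $E^n$ is the set of paths of length $n$, $E^*=\bigcup_{n\ge 0}E^n$. For formal symbols $e^*$ ($e\in E^1$) put $\alpha^*:=e_n^*\cdots e_1^*$ and $v^*:=v$. Rings are not assumed commutative or unital, and ring homomorphisms are additive and multiplicative maps. For $R$ a commutative ring with unit $1$, an $R$-algebra is a ring $A$ that is also a left $R$-module with $\lambda(xy)=(\lambda x)y=x(\lambda y)$ and $1\cdot x=x$; homomorphisms of $R$-algebras are $R$-linear ring homomorphisms. A Leavitt $E$-family in a ring is a collection $\{v,e,e^*:v\in E^0,e\in E^1\}$ of elements such that the $v$'s are pairwise orthogonal idempotents and: (1) $s(e)e=er(e)=e$; (2) $r(e)e^*=e^*s(e)=e^*$;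 (3) $e^*f=\delta_{e,f}\,r(e)$ for all $e,f\in E^1$; (4) $v=\sum_{s(e)=v}ee^*$ for every $v\in E^0_{\mathrm{reg}}$. The Leavitt path algebra $L_R(E)$ is the universal $R$-algebra generated by a Leavitt $E$-family $\{v,e,e^*\}$: every Leavitt $E$-family $\{a_v,b_e,c_{e^*}\}$ in an $R$-algebra $A$ is the image of the generators under an $R$-algebra homomorphism $L_R(E)\to A$ with $v\mapsto a_v$, $e\mapsto b_e$, $e^*\mapsto c_{e^*}$. Paths and ghost paths $\alpha,\alpha^*$ are regarded as the corresponding products in $L_R(E)$. Grading: a ring $T$ is $\mathbb{Z}$-graded if it has additive subgroups $T_k$ ($k\in\mathbb{Z}$) with $T=\bigoplus_k T_k$ and $T_jT_k\subseteq T_{j+k}$. A ring homomorphism $\phi:T\to S$ of graded rings is graded if $\phi(T_k)\subseteq S_k$ for all $k$. $L_R(E)$ is graded by $L_R(E)_k=\{\sum_{i=1}^N \lambda_i\alpha_i\beta_i^*:\alpha_i,\beta_i\in E^*,\lambda_i\in R,|\alpha_i|-|\beta_i|=k \text{ for all } i\}$. *)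

(* Defs.v *)
From HB Require Import structures.
From mathcomp Require Import all_boot all_order all_algebra generic_quotient.
From mathcomp Require Import boolp classical_sets cardinality fsbigop.

Set Implicit Arguments.
Unset Strict Implicit.
Unset Printing Implicit Defensive.

Import GRing.Theory.
Local Open Scope classical_set_scope.
Local Open Scope ring_scope.

(* The multiplication of a non-unital ring is the one of the library's
   semigroupType; ** makes it available next to the additive notations. *)
Notation "x ** y" := (x * y)%g (at level 40, left associativity) : ring_scope.

HB.mixin Record Zmodule_Semigroup_isNuRing A
    of GRing.Zmodule A & Semigroup A := {
  numulDl : forall x y z : A, (x + y) ** z = x ** z + y ** z;
  numulDr : forall x y z : A, x ** (y + z) = x ** y + x ** z
}.

(* rings, neither commutative nor unital in general *)
#[short(type="nuRingType")]
HB.structure Definition NuRing :=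
  {A of Zmodule_Semigroup_isNuRing A & GRing.Zmodule A & Semigroup A}.

HB.mixin Record NuRing_Lmodule_isNuAlgebra (R : comPzRingType) A
    of NuRing A & GRing.Lmodule R A := {
  nuscaleAl : forall (a : R) (x y : A), a *: (x ** y) = (a *: x) ** y;
  nuscaleAr : forall (a : R) (x y : A), a *: (x ** y) = x ** (a *: y)
}.

#[short(type="nuAlgType")]
HB.structure Definition NuAlgebra (R : comPzRingType) :=
  {A of NuRing_Lmodule_isNuAlgebra R A & NuRing A & GRing.Lmodule R A}.

Definition nuring_hom (A B : nuRingType) (f : A -> B) : Prop :=
  {morph f : x y / x + y} /\ {morph f : x y / x ** y}.

Definition nualg_hom (R : comPzRingType) (A B : nuAlgType R) (f : A -> B) :
  Prop := nuring_hom f /\ scalable f.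

Record graded_by (T : nuRingType) (G : int -> set T) : Prop := GradedBy {
  grade0 : forall k, G k 0;
  gradeB : forall k x y, G k x -> G k y -> G k (x - y);
  gradeM : forall j k x y, G j x -> G k y -> G (j + k) (x ** y);
  (* T is the direct sum of the G k *)
  grade_direct : forall x : T, exists! f : int -> T,
    [/\ finite_set [set k | f k != 0], forall k, G k (f k) &
        x = \sum_(k \in [set: int]) f k]
}.

Definition graded_map (T S : nuRingType) (G : int -> set T) (H : int -> set S)
  (f : T -> S) : Prop := forall k x, G k x -> H k (f x).

Record digraph := Digraph {
  vertex : countType;
  edge : countType;
  src : edge -> vertex;
  rng : edge -> vertex
}.

Definition out_edges (E : digraph) (v : vertex E) : set (edge E) :=
  [set e | src e = v].

Definition regular (E : digraph) (v : vertex E) : Prop :=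
  finite_set (out_edges v) /\ out_edges v !=set0.

(* GEdges e p is the path whose successive edges are e :: p. *)
Inductive gpath (E : digraph) : Type :=
| GVertex of vertex E
| GEdges (e : edge E) (p : seq (edge E))
    of path (fun f g => rng f == src g) e p.

Definition gpath_length (E : digraph) (a : gpath E) : nat :=
  match a with GVertex _ => 0 | GEdges _ p _ => (size p).+1 end.

Record edge_family (E : digraph) (A : Type) := EdgeFamily {
  fvtx : vertex E -> A;
  fedge : edge E -> A;
  fghost : edge E -> A
}.

Record leavitt_family (E : digraph) (A : nuRingType) (X : edge_family E A) :
    Prop := LeavittFamily {
  leavitt_vtx : forall v w,
    fvtx X v ** fvtx X w = if v == w then fvtx X v else 0;
  leavitt_src : forall e, fvtx X (src e) ** fedge X e = fedge X e;
  leavitt_rng : forall e, fedge X e ** fvtx X (rng e) = fedge X e;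
  leavitt_ghost_rng : forall e, fvtx X (rng e) ** fghost X e = fghost X e;
  leavitt_ghost_src : forall e, fghost X e ** fvtx X (src e) = fghost X e;
  leavitt_CK1 : forall e f,
    fghost X e ** fedge X f = if e == f then fvtx X (rng e) else 0;
  leavitt_CK2 : forall v, regular v ->
    fvtx X v = \sum_(e \in out_edges v) (fedge X e ** fghost X e)
}.

Definition path_elt (E : digraph) (A : nuRingType) (X : edge_family E A)
    (a : gpath E) : A :=
  match a with
  | GVertex v => fvtx X v
  | GEdges e p _ => foldl (fun x f => x ** fedge X f) (fedge X e) p
  end.

Definition ghost_elt (E : digraph) (A : nuRingType) (X : edge_family E A)
    (a : gpath E) : A :=
  match a with
  | GVertex v => fvtx X v
  | GEdges e p _ => foldl (fun x f => fghost X f ** x) (fghost X e) p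
  end.

Record subalgebra (R : comPzRingType) (A : nuAlgType R) (B : set A) : Prop :=
  Subalgebra {
  subalgebra0 : B 0;
  subalgebraB : forall x y, B x -> B y -> B (x - y);
  subalgebraM : forall x y, B x -> B y -> B (x ** y);
  subalgebraZ : forall (a : R) x, B x -> B (a *: x)
}.

(* (L, X) is the universal R-algebra generated by a Leavitt E-family. *)
Record is_leavitt_path_algebra (R : comPzRingType) (E : digraph)
    (L : nuAlgType R) (X : edge_family E L) : Prop := IsLeavittPathAlgebra {
  lpa_family : leavitt_family X;
  lpa_generated : forall B : set L, subalgebra B ->
    (forall v, B (fvtx X v)) -> (forall e, B (fedge X e)) ->
    (forall e, B (fghost X e)) -> B = [set: L];
  lpa_universal : forall (A : nuAlgType R) (Y : edge_family E A),
    leavitt_family Y ->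
    exists f : L -> A, [/\ nualg_hom f,
      forall v, f (fvtx X v) = fvtx Y v,
      forall e, f (fedge X e) = fedge Y e &
      forall e, f (fghost X e) = fghost Y e]
}.

Definition lpa_grade (R : comPzRingType) (E : digraph) (L : nuAlgType R)
    (X : edge_family E L) (k : int) : set L :=
  [set x | exists (N : nat) (c : 'I_N -> R) (a b : 'I_N -> gpath E),
    (forall i, (gpath_length (a i))%:Z - (gpath_length (b i))%:Z = k) /\
    x = \sum_(i < N) c i *: (path_elt X (a i) ** ghost_elt X (b i))].

(* Existence: terms in the generators modulo the smallest congruence that
   contains the laws of an R-algebra and of a Leavitt E-family. *)
Section Existence.
Variables (R : comPzRingType) (E : digraph).

Inductive lterm : Type :=
| TV of vertex E | TE of edge E | TG of edge E
| T0 | TD of lterm & lterm | TN of lterm | TM of lterm & lterm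
| TZ of R & lterm.

Definition tsum (s : seq (edge E)) : lterm :=
  foldr (fun e x => TD (TM (TE e) (TG e)) x) T0 s.

Inductive lcong : lterm -> lterm -> Prop :=
| CRefl x : lcong x x
| CSym x y : lcong x y -> lcong y x
| CTrans x y z : lcong x y -> lcong y z -> lcong x z
| CD x x' y y' : lcong x x' -> lcong y y' -> lcong (TD x y) (TD x' y')
| CN x x' : lcong x x' -> lcong (TN x) (TN x')
| CM x x' y y' : lcong x x' -> lcong y y' -> lcong (TM x y) (TM x' y')
| CZ a x x' : lcong x x' -> lcong (TZ a x) (TZ a x')
| CaddA x y z : lcong (TD x (TD y z)) (TD (TD x y) z)
| CaddC x y : lcong (TD x y) (TD y x)
| Cadd0 x : lcong (TD T0 x) x
| CaddN x : lcong (TD (TN x) x) T0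
| CmulA x y z : lcong (TM x (TM y z)) (TM (TM x y) z)
| CmulDl x y z : lcong (TM (TD x y) z) (TD (TM x z) (TM y z))
| CmulDr x y z : lcong (TM x (TD y z)) (TD (TM x y) (TM x z))
| CscaleA a b x : lcong (TZ a (TZ b x)) (TZ (a * b) x)
| Cscale1 x : lcong (TZ 1 x) x
| CscaleDr a x y : lcong (TZ a (TD x y)) (TD (TZ a x) (TZ a y))
| CscaleDl x a b : lcong (TZ (a + b) x) (TD (TZ a x) (TZ b x))
| CscaleAl a x y : lcong (TZ a (TM x y)) (TM (TZ a x) y)
| CscaleAr a x y : lcong (TZ a (TM x y)) (TM x (TZ a y))
| Cvtx v w : lcong (TM (TV v) (TV w)) (if v == w then TV v else T0)
| Csrc e : lcong (TM (TV (src e)) (TE e)) (TE e)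
| Crng e : lcong (TM (TE e) (TV (rng e))) (TE e)
| Cgrng e : lcong (TM (TV (rng e)) (TG e)) (TG e)
| Cgsrc e : lcong (TM (TG e) (TV (src e))) (TG e)
| CCK1 e f : lcong (TM (TG e) (TE f)) (if e == f then TV (rng e) else T0)
| CCK2 v s : regular v -> uniq s -> (forall e, (e \in s) = (src e == v)) ->
    lcong (TV v) (tsum s).

Definition lcongb (x y : {classic lterm}) : bool := `[< lcong x y >].

Lemma lcongb_refl : reflexive lcongb.
Proof. by move=> x; apply/asboolP; exact: CRefl. Qed.
Lemma lcongb_sym : symmetric lcongb.
Proof. by move=> x y; apply/asboolP/asboolP; exact: CSym. Qed.
Lemma lcongb_trans : transitive lcongb.
Proof.
by move=> y x z /asboolP xy /asboolP yz; apply/asboolP; exact: CTrans xy yz.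
Qed.

Canonical lcong_equiv :=
  EquivRel lcongb lcongb_refl lcongb_sym lcongb_trans.

Definition lpa := {eq_quot lcong_equiv}%qT.
HB.instance Definition _ := Choice.on lpa.

Definition cl (x : lterm) : lpa := (\pi_lpa (x : {classic lterm}))%qT.
Definition rp (x : lpa) : lterm := repr x.

Lemma rpK x : cl (rp x) = x. Proof. exact: reprK. Qed.
Lemma cl_eq x y : lcong x y -> cl x = cl y.
Proof. by move=> xy; apply/eqmodP; apply/asboolP. Qed.
Lemma rp_cl x : lcong (rp (cl x)) x.
Proof.
have /eqmodP/asboolP : cl (rp (cl x)) = cl x by rewrite rpK.
by [].
Qed.

Definition ladd x y := cl (TD (rp x) (rp y)).
Definition lopp x := cl (TN (rp x)).
Definition lmul x y := cl (TM (rp x) (rp y)).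
Definition lscale a x := cl (TZ a (rp x)).

Lemma laddE x y : ladd (cl x) (cl y) = cl (TD x y).
Proof. by apply/cl_eq/CD; exact: rp_cl. Qed.
Lemma loppE x : lopp (cl x) = cl (TN x).
Proof. by apply/cl_eq/CN; exact: rp_cl. Qed.
Lemma lmulE x y : lmul (cl x) (cl y) = cl (TM x y).
Proof. by apply/cl_eq/CM; exact: rp_cl. Qed.
Lemma lscaleE a x : lscale a (cl x) = cl (TZ a x).
Proof. by apply/cl_eq/CZ; exact: rp_cl. Qed.

Lemma laddA : associative ladd.
Proof.
move=> x y z; rewrite -(rpK x) -(rpK y) -(rpK z) !laddE.
by apply/cl_eq; constructor.
Qed.
Lemma laddC : commutative ladd.
Proof.
by move=> x y; rewrite -(rpK x) -(rpK y) !laddE; apply/cl_eq; constructor.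
Qed.
Lemma ladd0 : left_id (cl T0) ladd.
Proof. by move=> x; rewrite -(rpK x) !laddE; apply/cl_eq; constructor. Qed.
Lemma laddN : left_inverse (cl T0) lopp ladd.
Proof.
by move=> x; rewrite -(rpK x) loppE laddE; apply/cl_eq; constructor.
Qed.
HB.instance Definition _ := GRing.isZmodule.Build lpa laddA laddC ladd0 laddN.

Lemma lmulA : associative lmul.
Proof.
move=> x y z; rewrite -(rpK x) -(rpK y) -(rpK z) !lmulE.
by apply/cl_eq; constructor.
Qed.
HB.instance Definition _ := isSemigroup.Build lpa lmulA.

Lemma lmulDl (x y z : lpa) : (x + y) ** z = x ** z + y ** z.
Proof.
rewrite -(rpK x) -(rpK y) -(rpK z).
rewrite [LHS](_ : _ = cl (TM (TD (rp x) (rp y)) (rp z))); last first.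
  by rewrite -lmulE -laddE.
rewrite [RHS](_ : _ = cl (TD (TM (rp x) (rp z)) (TM (rp y) (rp z)))).
  by apply/cl_eq; constructor.
by rewrite -laddE -!lmulE.
Qed.
Lemma lmulDr (x y z : lpa) : x ** (y + z) = x ** y + x ** z.
Proof.
rewrite -(rpK x) -(rpK y) -(rpK z).
rewrite [LHS](_ : _ = cl (TM (rp x) (TD (rp y) (rp z)))); last first.
  by rewrite -lmulE -laddE.
rewrite [RHS](_ : _ = cl (TD (TM (rp x) (rp y)) (TM (rp x) (rp z)))).
  by apply/cl_eq; constructor.
by rewrite -laddE -!lmulE.
Qed.
HB.instance Definition _ :=
  Zmodule_Semigroup_isNuRing.Build lpa lmulDl lmulDr.

Lemma lscaleA a b (x : lpa) : lscale a (lscale b x) = lscale (a * b) x.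
Proof. by rewrite -(rpK x) !lscaleE; apply/cl_eq; constructor. Qed.
Lemma lscale1 : left_id 1 lscale.
Proof. by move=> x; rewrite -(rpK x) !lscaleE; apply/cl_eq; constructor. Qed.
Lemma lscaleDr : right_distributive lscale (+%R : lpa -> lpa -> lpa).
Proof.
move=> a x y; rewrite -(rpK x) -(rpK y).
have addE s t : cl s + cl t = cl (TD s t) by exact: laddE.
by rewrite addE !lscaleE addE; apply/cl_eq; constructor.
Qed.
Lemma lscaleDl (x : lpa) : {morph lscale^~ x : a b / a + b}.
Proof.
move=> a b /=; rewrite -(rpK x) !lscaleE.
have addE s t : cl s + cl t = cl (TD s t) by exact: laddE.
by rewrite addE; apply/cl_eq; constructor.
Qed.
HB.instance Definition _ := GRing.Zmodule_isLmodule.Build R lpa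
  lscaleA lscale1 lscaleDr lscaleDl.

Lemma clD x y : cl x + cl y = cl (TD x y). Proof. exact: laddE. Qed.
Lemma clN x : - cl x = cl (TN x). Proof. exact: loppE. Qed.
Lemma clM x y : cl x ** cl y = cl (TM x y). Proof. exact: lmulE. Qed.
Lemma clZ a x : a *: cl x = cl (TZ a x). Proof. exact: lscaleE. Qed.

Lemma lscaleAl (a : R) (x y : lpa) : a *: (x ** y) = (a *: x) ** y.
Proof.
by rewrite -(rpK x) -(rpK y) [cl _ ** cl _ in LHS]clM !clZ clM; apply/cl_eq; constructor.
Qed.
Lemma lscaleAr (a : R) (x y : lpa) : a *: (x ** y) = x ** (a *: y).
Proof.
by rewrite -(rpK x) -(rpK y) [cl _ ** cl _ in LHS]clM !clZ clM; apply/cl_eq; constructor.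
Qed.
HB.instance Definition _ :=
  NuRing_Lmodule_isNuAlgebra.Build R lpa lscaleAl lscaleAr.

Definition lpa_gen : edge_family E lpa :=
  EdgeFamily (cl \o TV) (cl \o TE) (cl \o TG).

Lemma fsum_out (A : nuRingType) (F : edge E -> A) v s :
  uniq s -> (forall e, (e \in s) = (src e == v)) ->
  \sum_(e \in out_edges v) F e = \sum_(e <- s) F e.
Proof.
move=> us sP; have -> : out_edges v = [set` s].
  by apply/seteqP; split=> e /=; rewrite sP => /eqP.
by rewrite -fsbig_seq.
Qed.

Lemma lpa_gen_family : leavitt_family lpa_gen.
Proof.
split=> /=.
- by move=> v w; rewrite clM (cl_eq (Cvtx v w)); case: eqP.
- by move=> e; rewrite clM; apply/cl_eq; constructor.
- by move=> e; rewrite clM; apply/cl_eq; constructor.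
- by move=> e; rewrite clM; apply/cl_eq; constructor.
- by move=> e; rewrite clM; apply/cl_eq; constructor.
- by move=> e f; rewrite clM (cl_eq (CCK1 e f)); case: eqP.
move=> v vreg; have [/finite_seqP [s0 s0P] _] := vreg.
have sP e : (e \in undup s0) = (src e == v).
  rewrite mem_undup; apply/idP/eqP => [es|ev].
    by have : [set` s0] e by []; rewrite -s0P.
  by have : out_edges v e by []; rewrite s0P.
rewrite (fsum_out _ (undup_uniq s0) sP) (cl_eq (CCK2 vreg (undup_uniq s0) sP)).
elim: (undup s0) => [|e s IH] /=; first by rewrite big_nil.
by rewrite big_cons -IH clM clD.
Qed.

Section Eval.
Variables (A : nuAlgType R) (Y : edge_family E A).

Fixpoint leval (x : lterm) : A :=
  match x with
  | TV v => fvtx Y v | TE e => fedge Y e | TG e => fghost Y e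
  | T0 => 0 | TD x y => leval x + leval y | TN x => - leval x
  | TM x y => leval x ** leval y | TZ a x => a *: leval x
  end.

Lemma leval_cong : leavitt_family Y ->
  forall x y, lcong x y -> leval x = leval y.
Proof.
move=> HY x y; elim=> //=; try by move=> *; congruence.
- by move=> *; rewrite addrA.
- by move=> *; rewrite addrC.
- by move=> *; rewrite add0r.
- by move=> *; rewrite addNr.
- by move=> *; rewrite mulgA.
- by move=> *; rewrite numulDl.
- by move=> *; rewrite numulDr.
- by move=> *; rewrite scalerA.
- by move=> *; rewrite scale1r.
- by move=> *; rewrite scalerDr.
- by move=> *; rewrite scalerDl.
- by move=> *; rewrite nuscaleAl.
- by move=> *; rewrite nuscaleAr.
- by move=> v w; rewrite (leavitt_vtx HY); case: eqP.
- by move=> *; rewrite (leavitt_src HY).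
- by move=> *; rewrite (leavitt_rng HY).
- by move=> *; rewrite (leavitt_ghost_rng HY).
- by move=> *; rewrite (leavitt_ghost_src HY).
- by move=> e f; rewrite (leavitt_CK1 HY); case: eqP.
move=> v s vreg us sP; rewrite (leavitt_CK2 HY vreg) (fsum_out _ us sP).
by elim: s {us sP} => [|e s IH] /=; rewrite ?big_nil ?big_cons ?IH.
Qed.
End Eval.

Lemma lpa_gen_universal : is_leavitt_path_algebra lpa_gen.
Proof.
split; first exact: lpa_gen_family.
- move=> B [B0 BB BM BZ] Bv Be Bg; apply/seteqP; split=> // x _.
  rewrite -(rpK x); elim: (rp x) => //=.
  + move=> s Bs t Bt; rewrite -clD -[cl t]opprK; apply: (BB _ _ Bs).
    by rewrite -sub0r; apply: BB.
  + by move=> s Bs; rewrite -clN -sub0r; apply: BB.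
  + by move=> s Bs t Bt; rewrite -clM; apply: BM.
  + by move=> a s Bs; rewrite -clZ; apply: BZ.
move=> A Y HY; exists (fun x => leval Y (rp x)).
have evE s : leval Y (rp (cl s)) = leval Y s.
  by apply: leval_cong => //; exact: rp_cl.
split; [split; [split|] | by move=> ? /= | by move=> ? /= | by move=> ? /=].
- by move=> x y; rewrite -(rpK x) -(rpK y) clD !evE.
- by move=> x y; rewrite -(rpK x) -(rpK y) clM !evE.
- by move=> a x; rewrite -(rpK x) clZ !evE.
all: by rewrite evE.
Qed.

End Existence.

Lemma leavitt_path_algebra_exists (R : comPzRingType) (E : digraph) :
  exists (L : nuAlgType R) (X : edge_family E L), is_leavitt_path_algebra X.
Proof. by exists (lpa R E), (lpa_gen R E); exact: lpa_gen_universal. Qed.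

(* Main.v *)
Require Import Defs.
From HB Require Import structures.
From mathcomp Require Import all_boot all_order all_algebra.
From mathcomp Require Import boolp classical_sets cardinality fsbigop.
Set Implicit Arguments.
Unset Strict Implicit.
Unset Printing Implicit Defensive.
Import GRing.Theory.
Local Open Scope classical_set_scope.
Local Open Scope ring_scope.

(** The kernel K of phi is a two-sided ideal that contains no c v with c <> 0.
    Such an ideal contains no nonzero homogeneous element ([ideal_homog]), and
    gradedness of phi lets one treat an element of K one homogeneous component
    at a time ([homogz_decomp], [graded_sum0]).

    Let x in K be homogeneous. If its degree is positive, every monomial of x
    starts with an edge, so x = sum_(e in F) e (e^* x) for some finite F; the
    elements e^* x are in K and have smaller degree, hence vanish by induction.
    Negative degrees are symmetric.

    In degree 0, let N bound the length of the paths alpha, beta in the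
    monomials c alpha beta^* of x, and argue by induction on N. Collect the
    monomials of length 0 in a = sum_v c_v v, and put p = sum_(e in F) e e^*
    for a finite set F of edges so large that x - a = p (x - a) p. All the
    e^* x f are in K with paths of length at most N - 1, so they vanish, p x p
    vanishes, and x = a - p a p. It remains to see v x = 0 for each vertex v
    ([ideal_corner]), since vertices provide local units ([vtx_separate]).
    A computation gives v x = c_v (v - v p). If some edge e outside F starts
    at v, then e^* (v x) e = c_v r(e) is in K and c_v = 0. Otherwise F contains
    all edges starting at v: if there are none, then v x = c_v v is in K and
    again c_v = 0; if there are some, v is regular and v = v p by the second
    Cuntz-Krieger relation. *)

(** * Rings without unit *)

Section NonunitalRing.
Variable A : nuRingType.
Implicit Types x y z : A.

Lemma numul0 x : 0 ** x = 0.
Proof. by apply: (addrI (0 ** x)); rewrite -numulDl !addr0. Qed.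

Lemma numulr0 x : x ** 0 = 0.
Proof. by apply: (addrI (x ** 0)); rewrite -numulDr !addr0. Qed.

Lemma numulBl x y z : (x - y) ** z = x ** z - y ** z.
Proof. by apply: (addIr (y ** z)); rewrite -numulDl !subrK. Qed.

Lemma numulBr x y z : x ** (y - z) = x ** y - x ** z.
Proof. by apply: (addIr (x ** z)); rewrite -numulDr !subrK. Qed.

Lemma numul_suml (I : Type) (s : seq I) (P : pred I) (F : I -> A) x :
  (\sum_(i <- s | P i) F i) ** x = \sum_(i <- s | P i) F i ** x.
Proof.
by apply: (big_morph (fun y => y ** x)) => [y z|]; rewrite ?numulDl ?numul0.
Qed.

Lemma numul_sumr (I : Type) (s : seq I) (P : pred I) (F : I -> A) x :
  x ** (\sum_(i <- s | P i) F i) = \sum_(i <- s | P i) x ** F i.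
Proof.
by apply: (big_morph (fun y => x ** y)) => [y z|]; rewrite ?numulDr ?numulr0.
Qed.

(** Scalars are absent, since the sets M of use are stable under them; being
    inductive, it transports additive properties from M to sums. *)
Inductive addspan (M : set A) : A -> Prop :=
| addspan0 : addspan M 0
| addspan_gen x : M x -> addspan M x
| addspanD x y : addspan M x -> addspan M y -> addspan M (x + y).

Lemma addspan_map (M N : set A) (f : A -> A) :
  f 0 = 0 -> {morph f : x y / x + y} -> (forall x, M x -> addspan N (f x)) ->
  forall x, addspan M x -> addspan N (f x).
Proof.
move=> f0 fD fM x; elim=> [|y /fM//|y z _ IHy _ IHz].
  by rewrite f0; exact: addspan0.
by rewrite fD; exact: addspanD.
Qed.

Lemma addspan_mull (M N : set A) a :
  (forall x, M x -> addspan N (a ** x)) ->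
  forall x, addspan M x -> addspan N (a ** x).
Proof.
by apply: addspan_map => [|x y]; rewrite ?numulr0 ?numulDr.
Qed.

Lemma addspan_mulr (M N : set A) a :
  (forall x, M x -> addspan N (x ** a)) ->
  forall x, addspan M x -> addspan N (x ** a).
Proof.
by apply: (@addspan_map M N (fun x => x ** a)) => [|x y]; rewrite ?numul0 ?numulDl.
Qed.

(** ** Finite sums of orthogonal idempotents *)

Section OrthogonalIdempotents.
Variables (I : eqType) (q : I -> A).
Hypothesis qM : forall i j, q i ** q j = if i == j then q i else 0.

Definition isum s := \sum_(i <- s) q i.

Lemma isum_mull s i : uniq s -> i \in s -> isum s ** q i = q i.
Proof.
move=> us si; rewrite numul_suml (bigD1_seq i) //= qM eqxx big1 ?addr0 // => j.
by rewrite qM => /negPf ->.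
Qed.

Lemma isum_mulr s i : uniq s -> i \in s -> q i ** isum s = q i.
Proof.
move=> us si; rewrite numul_sumr (bigD1_seq i) //= qM eqxx big1 ?addr0 // => j.
by rewrite qM eq_sym => /negPf ->.
Qed.

(** An element absorbed by one sum of orthogonal idempotents is absorbed by
    every larger one: this is what makes [lfix] and [rfix] additive, because
    two finite sets of indices can be replaced by their union. *)
Lemma isum_widenl s s' x :
  uniq s' -> {subset s <= s'} -> isum s ** x = x -> isum s' ** x = x.
Proof.
move=> us' ss' sx; rewrite -sx mulgA; congr (_ ** x).
rewrite numul_sumr; apply: eq_big_seq => i /ss'; exact: isum_mull.
Qed.

Lemma isum_widenr s s' x :
  uniq s' -> {subset s <= s'} -> x ** isum s = x -> x ** isum s' = x.
Proof.
move=> us' ss' sx; rewrite -sx -mulgA; congr (x ** _).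
rewrite numul_suml; apply: eq_big_seq => i /ss'; exact: isum_mulr.
Qed.

Lemma isum_idem s : uniq s -> isum s ** isum s = isum s.
Proof.
by move=> us; rewrite numul_sumr; apply: eq_big_seq => i; exact: isum_mull.
Qed.

Definition lfix x := exists2 s, uniq s & isum s ** x = x.
Definition rfix x := exists2 s, uniq s & x ** isum s = x.

Lemma lfix0 : lfix 0. Proof. by exists [::]; rewrite ?numulr0. Qed.
Lemma rfix0 : rfix 0. Proof. by exists [::]; rewrite ?numul0. Qed.

Lemma lfix1 i x : q i ** x = x -> lfix x.
Proof. by move=> ix; exists [:: i]; rewrite // /isum big_seq1. Qed.

Lemma rfix1 i x : x ** q i = x -> rfix x.
Proof. by move=> ix; exists [:: i]; rewrite // /isum big_seq1. Qed.

Let sub1 (s t : seq I) : {subset s <= undup (s ++ t)}.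
Proof. by move=> i si; rewrite mem_undup mem_cat si. Qed.
Let sub2 (s t : seq I) : {subset t <= undup (s ++ t)}.
Proof. by move=> i si; rewrite mem_undup mem_cat si orbT. Qed.

Lemma lfixB x y : lfix x -> lfix y -> lfix (x - y).
Proof.
case=> s us sx [t ut ty]; exists (undup (s ++ t)); first exact: undup_uniq.
by rewrite numulBr (isum_widenl _ (@sub1 s t) sx) ?(isum_widenl _ (@sub2 s t) ty)
  ?undup_uniq.
Qed.

Lemma lfixD x y : lfix x -> lfix y -> lfix (x + y).
Proof.
move=> fx fy; rewrite -[y]opprK; apply: lfixB => //.
by rewrite -sub0r; apply: lfixB => //; exact: lfix0.
Qed.

Lemma rfixD x y : rfix x -> rfix y -> rfix (x + y).
Proof.
case=> s us sx [t ut ty]; exists (undup (s ++ t)); first exact: undup_uniq.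
by rewrite numulDl (isum_widenr _ (@sub1 s t) sx) ?(isum_widenr _ (@sub2 s t) ty)
  ?undup_uniq.
Qed.

Lemma lrfix x : lfix x -> rfix x ->
  exists s, [/\ uniq s, isum s ** x = x & x ** isum s = x].
Proof.
case=> s us sx [t ut xt]; exists (undup (s ++ t)); split.
- exact: undup_uniq.
- exact: isum_widenl (undup_uniq _) (@sub1 s t) sx.
- exact: isum_widenr (undup_uniq _) (@sub2 s t) xt.
Qed.

End OrthogonalIdempotents.
End NonunitalRing.

(** * Graded rings *)

Section Grading.
Variables (S : nuRingType) (H : int -> set S) (hS : graded_by H).

Lemma gradeD k x y : H k x -> H k y -> H k (x + y).
Proof.
move=> hx hy; rewrite -[y]opprK; apply: (gradeB hS) => //.
by rewrite -sub0r; apply: (gradeB hS) => //; exact: (grade0 hS).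
Qed.

(** The family g on s and the zero family are both decompositions of 0 into
    homogeneous components. *)
Lemma graded_sum0 (g : int -> S) (s : seq int) :
  uniq s -> (forall k, H k (g k)) -> \sum_(k <- s) g k = 0 ->
  {in s, forall k, g k = 0}.
Proof.
move=> us hg gs0 k ks; have [f [_ fU]] := grade_direct hS 0.
pose h j := if j \in s then g j else 0.
have fh : f = h.
  apply: fU; split.
  - apply: (sub_finite_set _ (finite_seq s)) => j /=.
    by rewrite /h; case: ifP => // _; rewrite eqxx.
  - by move=> j; rewrite /h; case: ifP => // _; exact: (grade0 hS).
  rewrite -(@fsbig_widen _ _ _ _ [set` s]) //.
    by rewrite -fsbig_seq // -[LHS]gs0; apply: eq_big_seq => j js; rewrite /h js.
  by move=> j [_ /= /negP js]; rewrite /h (negPf js).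
have f0 : f = fun=> 0.
  apply: fU; split=> [|j|]; last by rewrite fsbig1.
  - by rewrite (_ : [set _ | _] = set0) //; apply/seteqP; split=> j //=; rewrite eqxx.
  - exact: (grade0 hS).
by have := congr1 (@^~ k) fh; rewrite f0 /h ks.
Qed.

End Grading.

(** * Monomials in a Leavitt family *)

Section LeavittFamily.
Variables (R : comPzRingType) (E : digraph) (L : nuAlgType R).
Variables (X : edge_family E L) (hX : leavitt_family X).
Implicit Types (v w : vertex E) (e f : edge E) (x y a : L).
Local Notation V := (fvtx X).
Local Notation D := (fedge X).
Local Notation G := (fghost X).

Lemma vtx_edge v e : V v ** D e = if v == src e then D e else 0.
Proof.
rewrite -{1}(leavitt_src hX) mulgA (leavitt_vtx hX).
by case: eqP => [->|]; rewrite ?numul0 // (leavitt_src hX).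
Qed.

Lemma ghost_vtx v e : G e ** V v = if v == src e then G e else 0.
Proof.
rewrite -{1}(leavitt_ghost_src hX) -mulgA (leavitt_vtx hX) eq_sym.
by case: eqP => [_|_]; rewrite ?numulr0 // (leavitt_ghost_src hX).
Qed.

Definition edge_proj e := D e ** G e.

Lemma edge_projM e f :
  edge_proj e ** edge_proj f = if e == f then edge_proj e else 0.
Proof.
rewrite /edge_proj mulgA -(mulgA (D e)) (leavitt_CK1 hX).
by case: eqP => [->|]; rewrite ?numulr0 ?numul0 // (leavitt_rng hX).
Qed.

Lemma vtx_edge_proj v e :
  V v ** edge_proj e = if v == src e then edge_proj e else 0.
Proof. by rewrite mulgA vtx_edge; case: ifP; rewrite ?numul0. Qed.

(** The elements c alpha beta^* with |alpha| = m and |beta| = n. Words of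
    edges that do not compose also arise, with value 0; in accordance with that,
    0 is in every bidegree, so that the product of a monomial with a generator
    is always a monomial. *)
Inductive mono : nat -> nat -> L -> Prop :=
| mono0 m n : mono m n 0
| mono_vtx (c : R) v : mono 0 0 (c *: V v)
| mono_edge e m n x : mono m n x -> mono m.+1 n (D e ** x)
| mono_ghost e m n x : mono m n x -> mono m n.+1 (x ** G e).

Lemma monoZ (c : R) m n x : mono m n x -> mono m n (c *: x).
Proof.
elim=> [*|*|e {}m {}n {}x _ IH|e {}m {}n {}x _ IH].
- by rewrite scaler0; exact: mono0.
- by rewrite scalerA; exact: mono_vtx.
- by rewrite nuscaleAr; exact: mono_edge.
- by rewrite nuscaleAl; exact: mono_ghost.
Qed.

Lemma mono_vtxl v m n x : mono m n x -> mono m n (V v ** x).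
Proof.
elim=> [*|c w|e {}m {}n {}x mx _|e {}m {}n {}x _ IH].
- by rewrite numulr0; exact: mono0.
- rewrite -nuscaleAr (leavitt_vtx hX).
  by case: ifP => _; rewrite ?scaler0; [exact: mono_vtx | exact: mono0].
- rewrite mulgA vtx_edge.
  by case: ifP => _; rewrite ?numul0; [exact: mono_edge | exact: mono0].
- by rewrite mulgA; exact: mono_ghost.
Qed.

Lemma mono_vtxr v m n x : mono m n x -> mono m n (x ** V v).
Proof.
elim=> [*|c w|e {}m {}n {}x _ IH|e {}m {}n {}x mx _].
- by rewrite numul0; exact: mono0.
- rewrite -nuscaleAl (leavitt_vtx hX).
  by case: ifP => _; rewrite ?scaler0; [exact: mono_vtx | exact: mono0].
- by rewrite -mulgA; exact: mono_edge.
- rewrite -mulgA ghost_vtx.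
  by case: ifP => _; rewrite ?numulr0; [exact: mono_ghost | exact: mono0].
Qed.

Lemma mono_ghost_edge e f m n x :
  mono m n x -> mono m n (G e ** (D f ** x)).
Proof.
move=> mx; rewrite mulgA (leavitt_CK1 hX); case: ifP => _.
  exact: mono_vtxl.
by rewrite numul0; exact: mono0.
Qed.

Lemma mono_cancell e m n x : mono m.+1 n x -> mono m n (G e ** x).
Proof.
move Ek: m.+1 => k mx; elim: mx m Ek => // {k n x}.
- by move=> *; rewrite numulr0; exact: mono0.
- by move=> f k n x mx _ m [->]; exact: mono_ghost_edge.
- by move=> f k n x _ IH m /IH mx; rewrite mulgA; exact: mono_ghost.
Qed.

Lemma mono_cancelr f m n x : mono m n.+1 x -> mono m n (x ** D f).
Proof.
move Ek: n.+1 => k mx; elim: mx n Ek => // {k m x}.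
- by move=> *; rewrite numul0; exact: mono0.
- by move=> e m k x _ IH n /IH mx; rewrite -mulgA; exact: mono_edge.
- move=> e m k x mx _ n [->]; rewrite -mulgA (leavitt_CK1 hX); case: ifP => _.
    exact: mono_vtxr.
  by rewrite numulr0; exact: mono0.
Qed.

(** A monomial that starts with the edge e is fixed by e e^*. *)
Lemma mono_lfix m n x : mono m.+1 n x -> lfix edge_proj x.
Proof.
move Ek: m.+1 => k mx; elim: mx m Ek => // {k n x}.
- by move=> *; exact: lfix0.
- move=> e k n x _ _ m _; apply: (@lfix1 _ _ _ e).
  by rewrite /edge_proj -mulgA (mulgA (G e)) (leavitt_CK1 hX) eqxx mulgA
    (leavitt_rng hX).
- by move=> e k n x _ IH m /IH [s us sx]; exists s; rewrite // mulgA sx.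
Qed.

Lemma mono_rfix m n x : mono m n.+1 x -> rfix edge_proj x.
Proof.
move Ek: n.+1 => k mx; elim: mx n Ek => // {k m x}.
- by move=> *; exact: rfix0.
- by move=> e m k x _ IH n /IH [s us sx]; exists s; rewrite // -mulgA sx.
- move=> e m k x _ _ n _; apply: (@rfix1 _ _ _ e).
  by rewrite /edge_proj mulgA -(mulgA x) (leavitt_CK1 hX) eqxx -mulgA
    (leavitt_ghost_rng hX).
Qed.

(** Models the finite sums of elements c_v v by the coefficients c_v alone. *)
Definition diagonal a := forall v, exists c : R, V v ** a = c *: V v.

Lemma diagonal0 : diagonal 0.
Proof. by move=> v; exists 0; rewrite scale0r numulr0. Qed.

Lemma diagonalD a b : diagonal a -> diagonal b -> diagonal (a + b).
Proof.
move=> da db v; have [c ac] := da v; have [d bd] := db v.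
by exists (c + d); rewrite numulDr ac bd scalerDl.
Qed.

Lemma mono_diagonal x : mono 0 0 x -> diagonal x.
Proof.
move E1: {1}0%N => m; move E2: 0%N => n mx.
case: mx E1 E2 => // {m n x} [*|c w _ _ v]; first exact: diagonal0.
exists (if v == w then c else 0); rewrite -nuscaleAr (leavitt_vtx hX).
by case: eqP => [->//|]; rewrite scaler0 scale0r.
Qed.

Lemma ghost_diagonal e a : diagonal a ->
  exists c : R, G e ** a = c *: G e.
Proof.
move=> /(_ (src e)) [c ac]; exists c.
by rewrite -(leavitt_ghost_src hX) -mulgA ac -nuscaleAr (leavitt_ghost_src hX).
Qed.

(** * Homogeneous elements of bounded depth *)

(** Elements of degree p - q. The bound N is what the degree 0 part of the
    argument runs its induction on, with p = q = 0. *)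
Definition homog p q N : L -> Prop :=
  addspan [set x | exists2 m, (m <= N)%N & mono (m + p) (m + q) x].

Lemma homog_cancell e p q N x : homog p.+1 q N x -> homog p q N (G e ** x).
Proof.
apply: addspan_mull => {}x [m mN mx]; apply: addspan_gen; exists m => //.
by apply: mono_cancell; rewrite -addnS.
Qed.

Lemma homog_cancelr e p q N x : homog p q.+1 N x -> homog p q N (x ** D e).
Proof.
apply: addspan_mulr => {}x [m mN mx]; apply: addspan_gen; exists m => //.
by apply: mono_cancelr; rewrite -addnS.
Qed.

Lemma homog_lfix p q N x : homog p.+1 q N x -> lfix edge_proj x.
Proof.
elim=> [|{}x [m _]|y z _ hy _ hz]; first exact: lfix0.
  by rewrite addnS; exact: mono_lfix.
exact: (lfixD edge_projM hy hz).
Qed.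

Lemma homog_rfix p q N x : homog p q.+1 N x -> rfix edge_proj x.
Proof.
elim=> [|{}x [m _]|y z _ hy _ hz]; first exact: rfix0.
  by rewrite addnS; exact: mono_rfix.
exact: (rfixD edge_projM hy hz).
Qed.

(** A monomial of positive length loses one edge on each side. One of length 0,
    c v, becomes a multiple of e^* f, again of length 0 and so within the
    bound N. *)
Lemma homog_cancel e f N x : homog 0 0 N.+1 x -> homog 0 0 N (G e ** x ** D f).
Proof.
move: x; apply: (@addspan_map _ _ _ (fun x => G e ** x ** D f)).
- by rewrite numulr0 numul0.
- by move=> x y; rewrite numulDr numulDl.
move=> x [[|m] mN]; rewrite !addn0 => mx; apply: addspan_gen; last first.
  by exists m => //; rewrite !addn0; apply/mono_cancelr/mono_cancell.
exists 0%N => //.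
have [c ->] := ghost_diagonal e (mono_diagonal mx).
rewrite -nuscaleAl (leavitt_CK1 hX); case: ifP => _; first exact: mono_vtx.
by rewrite scaler0; exact: mono0.
Qed.

Lemma homog00_diagonal x : homog 0 0 0 x -> diagonal x.
Proof.
elim=> [|{}x [m]|y z _ hy _ hz]; first exact: diagonal0.
  by rewrite leqn0 => /eqP->; exact: mono_diagonal.
exact: diagonalD.
Qed.

(** The element a collects the monomials of length 0; the others start with an
    edge and end with a ghost edge. *)
Lemma homog00_fix N x : homog 0 0 N x -> exists a,
  [/\ diagonal a, lfix edge_proj (x - a) & rfix edge_proj (x - a)].
Proof.
elim=> [|{}x [[|m] _]|y z _ [a [da la ra]] _ [b [db lb rb]]].
- by exists 0; rewrite subrr; split; [exact: diagonal0|exact: lfix0|exact: rfix0].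
- move=> /mono_diagonal dx; exists x; rewrite subrr.
  by split=> //; [exact: lfix0|exact: rfix0].
- rewrite !addn0 => mx; exists 0; rewrite subr0; split; first exact: diagonal0.
    exact: mono_lfix mx.
  exact: mono_rfix mx.
exists (a + b); rewrite opprD addrACA; split; first exact: diagonalD.
  exact: (lfixD edge_projM).
exact: (rfixD edge_projM).
Qed.

(** * Local units and the spanning set of monomials *)

Hypothesis hgen : forall B : set L, subalgebra B ->
    (forall v, B (V v)) -> (forall e, B (D e)) ->
    (forall e, B (G e)) -> B = [set: L].

Lemma local_unit x : lfix V x.
Proof.
suff -> : lfix V = [set: L] by [].
apply: hgen => [|v|e|e].
- split=> [|y z|y z [s us sy] _|c y [s us sy]]; first exact: lfix0.
  + exact: (lfixB (leavitt_vtx hX)).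
  + by exists s; rewrite // mulgA sy.
  + by exists s; rewrite // -nuscaleAr sy.
- by apply: (@lfix1 _ _ _ v); rewrite (leavitt_vtx hX) eqxx.
- by apply: (@lfix1 _ _ _ (src e)); exact: leavitt_src.
- by apply: (@lfix1 _ _ _ (rng e)); exact: leavitt_ghost_rng.
Qed.

Lemma vtx_separate x : (forall v, V v ** x = 0) -> x = 0.
Proof.
move=> vx0; have [s _ <-] := local_unit x.
by rewrite numul_suml big1.
Qed.

Lemma mono_ghostl e m n x :
  mono m n x -> exists m' n', mono m' n' (G e ** x).
Proof.
elim=> [*|c v|f {}m {}n {}x mx _|f {}m {}n {}x _ [m' [n' IH]]].
- by exists 0%N, 0%N; rewrite numulr0; exact: mono0.
- exists 0%N, 1%N; rewrite -nuscaleAr ghost_vtx; case: ifP => _.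
    rewrite -(leavitt_ghost_rng hX) nuscaleAl; apply: mono_ghost.
    exact: mono_vtx.
  by rewrite scaler0; exact: mono0.
- by exists m, n; exact: mono_ghost_edge.
- by exists m', n'.+1; rewrite mulgA; exact: mono_ghost.
Qed.

(** The additive span W of the monomials is stable under left multiplication
    by the generators. The elements t with t W contained in W form a
    subalgebra, hence everything, so W is a subalgebra; it contains the
    generators. *)
Lemma mono_span x : addspan [set y | exists m n, mono m n y] x.
Proof.
set W := addspan _; rewrite -/(W x).
have Wm m n y : mono m n y -> W y by move=> ?; apply: addspan_gen; exists m, n.
have WZ c y : W y -> W (c *: y).
  apply: (@addspan_map _ _ _ (fun z => c *: z)); first exact: scaler0.
    exact: scalerDr.
  by move=> z [m [n mz]]; apply: (Wm m n); exact: monoZ.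
have WB y z : W y -> W z -> W (y - z).
  by move=> Wy Wz; rewrite -scaleN1r; apply: addspanD => //; exact: WZ.
have WM y z : W y -> W z -> W (y ** z).
  suff : [set t | forall u, W u -> W (t ** u)] = [set: L].
    by move=> /seteqP[_ /(_ y I) /= By] _; exact: By.
  apply: hgen => [|v|e|e] /=.
  - split=> /= [u _|t t' Bt Bt' u Wu|t t' Bt Bt' u Wu|c t Bt u Wu].
    + by rewrite numul0; exact: addspan0.
    + by rewrite numulBl; apply: WB; [exact: Bt|exact: Bt'].
    + by rewrite -mulgA; apply: Bt; exact: Bt'.
    + by rewrite -nuscaleAl; apply: WZ; exact: Bt.
  - apply: addspan_mull => u [m [n mu]]; apply: (Wm m n); exact: mono_vtxl.
  - apply: addspan_mull => u [m [n mu]]; apply: (Wm m.+1 n); exact: mono_edge.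
  - apply: addspan_mull => u [m [n /(mono_ghostl e)[m' [n' mu]]]].
    exact: Wm mu.
have WV v : W (V v) by rewrite -[V v]scale1r; apply: (Wm 0%N 0%N); exact: mono_vtx.
suff /seteqP[_ /(_ x I)] : [set t | W t] = [set: L] by [].
apply: hgen => [|//|e|e] /=; first by split=> //; exact: addspan0.
- by rewrite -(leavitt_rng hX) -[V _]scale1r; apply: (Wm 1%N 0%N); apply: mono_edge;
  exact: mono_vtx.
- by rewrite -(leavitt_ghost_rng hX) -[V _]scale1r; apply: (Wm 0%N 1%N);
  apply: mono_ghost; exact: mono_vtx.
Qed.

(** * Ideals without multiples of vertices *)

Section Ideal.
Variable K : set L.
Hypothesis K_mull : forall y x, K x -> K (y ** x).
Hypothesis K_mulr : forall y x, K x -> K (x ** y).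
Hypothesis K_vtx : forall v (c : R), K (c *: V v) -> c = 0.

(** The heart of the argument, and the only place where the second
    Cuntz-Krieger relation enters: multiplied by v on the left, the element
    becomes c (v - v p), where p is the sum of the e e^* with e in F, and one
    distinguishes whether all edges starting at v belong to F. *)
Lemma ideal_corner a F : diagonal a -> uniq F ->
  K (a - isum edge_proj F ** a ** isum edge_proj F) ->
  a - isum edge_proj F ** a ** isum edge_proj F = 0.
Proof.
move=> da uF Kx; apply: vtx_separate => v; have [c ac] := da v.
set x := a - _ in Kx *; set P := isum edge_proj F in x Kx *.
have VP : V v ** P = \sum_(e <- F | src e == v) edge_proj e.
  rewrite numul_sumr [RHS]big_mkcond; apply: eq_bigr => e _.
  by rewrite vtx_edge_proj eq_sym.
have VPa : V v ** P ** a = c *: (V v ** P).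
  rewrite VP numul_suml scaler_sumr; apply: eq_bigr => e /eqP ev.
  rewrite /edge_proj -mulgA nuscaleAr; congr (_ ** _).
  by rewrite -(leavitt_ghost_src hX) ev -mulgA ac nuscaleAr.
have Vx : V v ** x = c *: (V v - V v ** P).
  rewrite numulBr ac !mulgA VPa -nuscaleAl -mulgA isum_idem //.
    by rewrite scalerBr.
  exact: edge_projM.
have [eF|[e [ev eF]]] : {subset out_edges v <= F} \/
    exists e, src e = v /\ e \notin F.
  case: (pselect (exists e, src e = v /\ e \notin F)); first by right.
  move=> nex; left=> e /set_mem ev; apply/negPn/negP => eF; apply: nex.
  by exists e.
(* All edges starting at v are in F: v is regular or it emits nothing. *)
- have sP e : (e \in [seq f <- F | src f == v]) = (src e == v).
    rewrite mem_filter; case: eqP => //= ev; apply: eF; exact: mem_set.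
  have [[e ev]|noe] := pselect (out_edges v !=set0).
    rewrite Vx VP -big_filter -(fsum_out _ (filter_uniq _ uF) sP).
    rewrite -(leavitt_CK2 hX) ?subrr ?scaler0 //; split; last by exists e.
    by apply/finite_seqP; exists [seq f <- F | src f == v];
      apply/seteqP; split=> f /=; rewrite sP => /eqP.
  have VP0 : V v ** P = 0.
    by rewrite VP big1 // => e /eqP ev; case: noe; exists e.
  have := K_mull (V v) Kx; rewrite Vx VP0 subr0 => /K_vtx ->.
  by rewrite scale0r.
(* The edge e starts at v and lies outside F: compress by e^* and e. *)
have PD : P ** D e = 0.
  rewrite numul_suml big1_seq // => f /andP[_ fF].
  rewrite /edge_proj -mulgA (leavitt_CK1 hX); case: eqP => [fe|].
    by rewrite -fe fF in eF.
  by rewrite numulr0.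
have := K_mulr (D e) (K_mull (G e) (K_mull (V v) Kx)).
rewrite Vx -nuscaleAr -nuscaleAl -mulgA numulBl -mulgA PD numulr0 subr0.
rewrite vtx_edge -ev eqxx (leavitt_CK1 hX) eqxx => /K_vtx ->.
by rewrite scale0r.
Qed.

Lemma ideal_homog00 N x : homog 0 0 N x -> K x -> x = 0.
Proof.
elim: N x => [|N IH] x hx Kx.
  (* The case of an empty F: x is its own diagonal part. *)
  have P0 : isum edge_proj [::] = 0 :> L by rewrite /isum big_nil.
  have := @ideal_corner x [::] (homog00_diagonal hx) isT.
  by rewrite P0 !numul0 subr0; apply.
have [a [da la ra]] := homog00_fix hx.
have [F [uF Fx xF]] := lrfix edge_projM la ra.
have cx e f : G e ** x ** D f = 0.
  by apply: IH; [exact: homog_cancel|apply/K_mulr/K_mull].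
have PxP : isum edge_proj F ** x ** isum edge_proj F = 0.
  rewrite numul_sumr big1 // => f _; rewrite !numul_suml big1 // => e _.
  by rewrite /edge_proj -!mulgA (mulgA x) (mulgA (G e)) (mulgA (G e)) cx
    numul0 numulr0.
have xE : x = a - isum edge_proj F ** a ** isum edge_proj F.
  apply: (addIr (- a)); rewrite -{1}Fx -{1}xF mulgA numulBr numulBl PxP sub0r.
  by rewrite addrAC subrr sub0r.
by rewrite xE; apply: ideal_corner => //; rewrite -xE.
Qed.

Lemma ideal_hom p q N x : homog p q N x -> K x -> x = 0.
Proof.
elim: p x => [|p IHp] x hx Kx; last first.
  have [F _ <-] := homog_lfix hx; rewrite numul_suml big1 // => e _.
  rewrite /edge_proj -mulgA (IHp (G e ** x)) ?numulr0 //; last exact: K_mull.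
  exact: homog_cancell.
elim: q x hx Kx => [|q IHq] x hx Kx; first exact: ideal_homog00 hx Kx.
have [F _ <-] := homog_rfix hx; rewrite numul_sumr big1 // => e _.
rewrite /edge_proj mulgA (IHq (x ** D e)) ?numul0 //; last exact: K_mulr.
exact: homog_cancelr.
Qed.

End Ideal.

(** * Homogeneous decomposition *)

Definition homogz (k : int) x : Prop :=
  match k with
  | Posz p => exists N, homog p 0 N x
  | Negz q => exists N, homog 0 q.+1 N x
  end.

Lemma homogW p q N N' x : (N <= N')%N -> homog p q N x -> homog p q N' x.
Proof.
move=> NN'; elim=> [|y [m mN my]|*]; first exact: addspan0.
  by apply: addspan_gen; exists m => //; exact: leq_trans NN'.
exact: addspanD.
Qed.

Lemma homogz0 k : homogz k 0.
Proof. by case: k => n; exists 0%N; exact: addspan0. Qed.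

Lemma homogzD k x y : homogz k x -> homogz k y -> homogz k (x + y).
Proof.
by case: k => n [N hx] [N' hy]; exists (maxn N N'); apply: addspanD;
  [apply: homogW hx|apply: homogW hy|apply: homogW hx|apply: homogW hy];
  rewrite ?leq_maxl ?leq_maxr.
Qed.

Lemma mono_homogz m n x : mono m n x -> homogz (m%:Z - n%:Z) x.
Proof.
move=> mx; have [nm|mn] := leqP n m.
  rewrite subzn //; exists n; apply: addspan_gen; exists n => //.
  by rewrite addn0 subnKC.
have -> : m%:Z - n%:Z = Negz (n - m).-1.
  by rewrite NegzE prednK ?subn_gt0 // -opprB subzn // ltnW.
exists m; apply: addspan_gen; exists m => //.
by rewrite addn0 prednK ?subn_gt0 // subnKC // ltnW.
Qed.

Lemma homogz_decomp x : exists (f : int -> L) (s : seq int),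
  [/\ uniq s, forall k, homogz k (f k) & x = \sum_(k <- s) f k].
Proof.
(* Vanishing outside s lets the induction add two decompositions that are
   indexed by different lists of degrees. *)
suff [f [s [us sf hf ->]]] : exists (f : int -> L) (s : seq int),
    [/\ uniq s, forall k, k \notin s -> f k = 0, forall k, homogz k (f k) &
      x = \sum_(k <- s) f k] by exists f, s.
elim: (mono_span x) => {x}
  [|x [m [n mx]]|x y _ [f [s [us sf hf ->]]] _ [g [t [ut tg hg ->]]]].
- exists (fun=> 0), [::]; split=> // [k|]; first exact: homogz0.
  by rewrite big_nil.
- pose d : int := m%:Z - n%:Z.
  exists (fun k => if k == d then x else 0), [:: d]; split=> // [k|k|].
  + by rewrite inE => /negPf ->.
  + by case: eqP => [->|_]; [exact: mono_homogz | exact: homogz0].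
  + by rewrite big_seq1 eqxx.
have widen h (r r' : seq int) : uniq r -> uniq r' -> {subset r <= r'} ->
    (forall k, k \notin r -> h k = 0 :> L) ->
    \sum_(k <- r) h k = \sum_(k <- r') h k.
  move=> ur ur' rr' h0; rewrite [RHS](bigID (mem r)) /= [X in _ + X]big1.
    rewrite addr0 -[RHS]big_filter; apply: perm_big; apply: uniq_perm => //.
      exact: filter_uniq.
    by move=> k; rewrite mem_filter; case: (boolP (k \in r)) => // /rr' ->.
  by move=> k; exact: h0.
exists (fun k => f k + g k), (undup (s ++ t)); split.
- exact: undup_uniq.
- move=> k; rewrite mem_undup mem_cat negb_or => /andP[ks kt].
  by rewrite sf // tg // addr0.
- by move=> k; exact: homogzD.
rewrite big_split /=; congr (_ + _); apply: widen => //; rewrite ?undup_uniq //.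
- by move=> k ks; rewrite mem_undup mem_cat ks.
- by move=> k ks; rewrite mem_undup mem_cat ks orbT.
Qed.

(** * Graded homomorphisms *)

Section GradedMap.
Variables (S : nuRingType) (H : int -> set S) (hS : graded_by H).
Variables (phi : L -> S) (hphi : nuring_hom phi).
Hypothesis hgr : graded_map (lpa_grade X) H phi.

Lemma lpa_grade1 c (a b : gpath E) :
  lpa_grade X ((gpath_length a)%:Z - (gpath_length b)%:Z)
    (c *: (path_elt X a ** ghost_elt X b)).
Proof.
exists 1%N, (fun=> c), (fun=> a), (fun=> b); split=> //.
by rewrite big_ord1.
Qed.

(** Vertices, edges and ghost edges are products of a path and a ghost path
    because of e = e r(e) and e^* = r(e) e^*. *)
Lemma graded_vtx c v : H 0 (phi (c *: V v)).
Proof.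
have := hgr (lpa_grade1 c (GVertex v) (GVertex v)).
by rewrite /= (leavitt_vtx hX) eqxx.
Qed.

Lemma graded_edge e : H 1 (phi (D e)).
Proof.
have ep : path (fun f g => rng f == src g) e [::] by [].
have := hgr (lpa_grade1 1 (GEdges ep) (GVertex (rng e))).
by rewrite /= scale1r (leavitt_rng hX).
Qed.

Lemma graded_ghost e : H (-1) (phi (G e)).
Proof.
have ep : path (fun f g => rng f == src g) e [::] by [].
have := hgr (lpa_grade1 1 (GVertex (rng e)) (GEdges ep)).
by rewrite /= scale1r (leavitt_ghost_rng hX).
Qed.

Lemma nuring_hom0 : phi 0 = 0.
Proof. by apply: (addrI (phi 0)); rewrite -hphi.1 !addr0. Qed.

Lemma graded_mono m n x : mono m n x -> H (m%:Z - n%:Z) (phi x).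
Proof.
elim=> [*|c v|e {}m {}n {}x _ IH|e {}m {}n {}x _ IH].
- by rewrite nuring_hom0; exact: (grade0 hS).
- exact: graded_vtx.
- rewrite hphi.2 intS -addrA; exact: (gradeM hS (graded_edge e) IH).
- rewrite hphi.2 intS opprD addrCA addrC; exact: (gradeM hS IH (graded_ghost e)).
Qed.

Lemma graded_homogz k x : homogz k x -> H k (phi x).
Proof.
have homog_gr p q N y : homog p q N y -> H (p%:Z - q%:Z) (phi y).
  elim=> [|{}y [m _ /graded_mono]|y1 y2 _ IH1 _ IH2].
  - by rewrite nuring_hom0; exact: (grade0 hS).
  - by rewrite !PoszD opprD addrACA subrr add0r.
  - by rewrite hphi.1; exact: (gradeD hS).
by case: k => n [N /homog_gr]; rewrite ?subr0 ?sub0r.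
Qed.

End GradedMap.
End LeavittFamily.

(** * The graded uniqueness theorem *)

Theorem theorem5p3 (R : comPzRingType) (E : digraph)
  (L : nuAlgType R) (X : edge_family E L) (hL : is_leavitt_path_algebra X)
  (S : nuRingType) (G : int -> set S) (hS : graded_by G)
  (phi : L -> S) (hphi : nuring_hom phi)
  (hgr : graded_map (lpa_grade X) G phi)
  (hv : forall (v : vertex E) (a : R), a != 0 -> phi (a *: fvtx X v) != 0) :
  injective phi.
Proof.
have [hX hgen _] := hL; have phi0 := nuring_hom0 hphi.
have phiD := hphi.1; have phiM := hphi.2.
pose K := [set x : L | phi x = 0].
have K_mull y x : K x -> K (y ** x) by rewrite /K /= phiM => ->; rewrite numulr0.
have K_mulr y x : K x -> K (x ** y) by rewrite /K /= phiM => ->; rewrite numul0.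
have K_vtx v (c : R) : K (c *: fvtx X v) -> c = 0.
  by move=> /eqP cv; apply/eqP; apply: contraLR cv; exact: hv.
have K0 x : phi x = 0 -> x = 0.
  have [f [s [us hf ->]]] := homogz_decomp hX hgen x.
  rewrite (big_morph phi phiD phi0) => sum0.
  have fK := graded_sum0 hS us (fun k => graded_homogz hX hS hphi hgr (hf k)) sum0.
  rewrite big1_seq // => k /andP[_ /fK Kk].
  by case: k (hf k) Kk => n [N hN];
    exact: (ideal_hom hX hgen K_mull K_mulr K_vtx hN).
move=> x y xy; apply: (addIr (- y)); rewrite subrr; apply: K0.
by rewrite phiD xy -phiD subrr.
Qed.
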